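(* Let $n$ be a positive integer, let $A\in\mathbb{R}^{n\times n}$, and let $\alpha\subseteq\{1,\dots,n\}$ with $|\alpha|=1$. Write $\bar\alpha=\{1,\dots,n\}\setminus\alpha$. Then $A$ is an N-matrix if and only if $A[\alpha]$ and $A[\bar\alpha]$ are N-matrices and $A/A[\alpha]$ is a P-matrix.
   Context: For $A\in\mathbb{R}^{n\times n}$ and $\alpha,\beta\subseteq\{1,\dots,n\}$, $A[\alpha,\beta]$ is the submatrix of $A$ with rows indexed by $\alpha$ and columns indexed by $\beta$ (indices in ascending order), and $A[\alpha]=A[\alpha,\alpha]$ is a principal submatrix, whose determinant is a principal minor. If $A[\alpha]$ is invertible, the Schur complement of $A[\alpha]$ in $A$ is $$A/A[\alpha]=A[\bar\alpha]-A[\bar\alpha,\alpha]\,A[\alpha]^{-1}A[\alpha,\bar\alpha].$$ (On the right-hand side of the equivalence, $A[\alpha]$ being an N-matrix means this $1\times 1$ matrix is negative, hence invertible, so the Schur complement is defined.) A real $n\times n$ matrix $A$ is an N-matrix if $\det A[\gamma]<0$ for all nonempty $\gamma\subseteq\{1,\dots,n\}$, and a P-matrix if $\det A[\gamma]>0$ for all nonempty $\gamma\subseteq\{1,\dots,n\}$. An empty ($0\times0$) matrix is vacuously both an N-matrix and a P-matrix; this only matters when $n=1$. *)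

(* Defs.v *)
From HB Require Import structures.
From mathcomp Require Import all_boot all_order all_algebra.

Set Implicit Arguments.
Unset Strict Implicit.
Unset Printing Implicit Defensive.

Import Order.TTheory GRing.Theory Num.Theory.
Local Open Scope ring_scope.

(* A[a, b].  [enum_val] lists the elements of a set of ordinals in increasing
   order, so rows and columns keep their ascending order. *)
Definition setsub_mx (R : Type) (n : nat) (A : 'M[R]_n) (a b : {set 'I_n}) :
    'M[R]_(#|a|, #|b|) :=
  mxsub (fun i : 'I_#|a| => enum_val i) (fun j : 'I_#|b| => enum_val j) A.

Definition principal_mx (R : Type) (n : nat) (A : 'M[R]_n) (a : {set 'I_n}) :
    'M[R]_#|a| :=
  setsub_mx A a a.

(* A / A[a].  Only meaningful when A[a] is invertible: [invmx] is the identity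
   function on singular matrices. *)
Definition schur_compl (R : comUnitRingType) (n : nat) (A : 'M[R]_n)
    (a : {set 'I_n}) : 'M[R]_#|~: a| :=
  principal_mx A (~: a)
    - setsub_mx A (~: a) a *m invmx (principal_mx A a) *m setsub_mx A a (~: a).

Definition N_matrix (R : numDomainType) (n : nat) (A : 'M[R]_n) : Prop :=
  forall g : {set 'I_n}, g != set0 -> \det (principal_mx A g) < 0.

Definition P_matrix (R : numDomainType) (n : nat) (A : 'M[R]_n) : Prop :=
  forall g : {set 'I_n}, g != set0 -> 0 < \det (principal_mx A g).

(* Main.v *)
Require Import Defs.
From HB Require Import structures.
From mathcomp Require Import all_boot all_order all_algebra.
From mathcomp Require Import perm.

Set Implicit Arguments.
Unset Strict Implicit.
Unset Printing Implicit Defensive.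

Import Order.TTheory GRing.Theory Num.Theory.
Local Open Scope ring_scope.

(** The theorem is a sign count based on the Crabtree-Haynsworth identity
    [det A[a :|: g] = det A[a] * det (A / A[a])[g]] for [g] disjoint from [a]
    ([det_principal_schur]).  When [a] is a singleton, every nonempty index set
    is either [a] itself, or a subset of [~: a], or [a] enlarged by a nonempty
    [g] disjoint from it.  Minors of the first two kinds are those of [A[a]]
    and [A[~: a]]; for the third kind, [det A[a] < 0] and the identity say that
    [det A[a :|: g] < 0] exactly when [det (A / A[a])[g] > 0].

    The identity itself comes from the block determinant formula applied to the
    rows and columns of [A] listed as those of [a] followed by those of [g].
    That order is not ascending, whence [det_mxsub_perm]: a principal minor
    depends only on the set of selected indices, because reordering rows and
    columns by the same permutation multiplies the determinant by the square of
    a sign. *)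

Lemma det_mxsub_perm (R : comNzRingType) (n m p : nat) (A : 'M[R]_n)
    (f : 'I_m -> 'I_n) (h : 'I_p -> 'I_n) :
  injective f -> injective h -> codom f =i codom h ->
  \det (mxsub f f A) = \det (mxsub h h A).
Proof.
move=> f_inj h_inj eq_fh.
have eq_mp : m = p.
  by rewrite -[m]card_ord -(card_codom f_inj) (eq_card eq_fh) card_codom ?card_ord.
case: p / eq_mp h h_inj eq_fh => h h_inj eq_fh.
have h_f i : h i \in codom f by rewrite eq_fh codom_f.
have s_inj : injective (fun i => iinv (h_f i)).
  by move=> i j /(congr1 f); rewrite !f_iinv => /h_inj.
have -> : mxsub h h A = row_perm (perm s_inj) (col_perm (perm s_inj) (mxsub f f A)).
  by apply/matrixP=> i j; rewrite !mxE !permE !f_iinv.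
rewrite row_permE col_permE !det_mulmx !det_perm odd_permV.
by rewrite mulrCA -signr_addb addbb mulr1.
Qed.

Lemma det_principal_mxsub (R : comNzRingType) (n m : nat) (A : 'M[R]_n)
    (f : 'I_m -> 'I_n) (g : {set 'I_n}) :
  injective f -> (forall x, (x \in codom f) = (x \in g)) ->
  \det (mxsub f f A) = \det (principal_mx A g).
Proof.
move=> f_inj fg; apply: det_mxsub_perm => // [|x]; first exact: enum_val_inj.
rewrite fg; apply/idP/codomP => [xg | [i ->]]; last exact: enum_valP.
by exists (enum_rank_in xg x); rewrite enum_rankK_in.
Qed.

(** Eliminating the lower left block by a block unitriangular factor leaves
    an upper block triangular matrix. *)
Lemma det_block_schur (R : comUnitRingType) (m p : nat) (A : 'M[R]_m)
    (B : 'M[R]_(m, p)) (C : 'M[R]_(p, m)) (D : 'M[R]_p) :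
  A \in unitmx ->
  \det (block_mx A B C D) = \det A * \det (D - C *m invmx A *m B).
Proof.
move=> uA.
have -> : block_mx A B C D =
    block_mx 1%:M 0 (C *m invmx A) 1%:M
      *m block_mx A B 0 (D - C *m invmx A *m B).
  by rewrite mulmx_block !mul1mx !mul0mx !addr0 mulmxKV // addrC subrK.
by rewrite det_mulmx det_lblock det_ublock !det1 !mul1r.
Qed.

Lemma codom_enum_val (n : nat) (a : {set 'I_n}) (g : {set 'I_#|a|}) x :
  (x \in codom (fun i : 'I_#|g| => enum_val (enum_val i))) =
  (x \in [set enum_val i | i in g]).
Proof.
apply/codomP/imsetP => [[i ->] | [i ig ->]].
  by exists (enum_val i); first exact: enum_valP.
by exists (enum_rank_in ig i); rewrite enum_rankK_in.
Qed.

Lemma det_principal_principal (R : comNzRingType) (n : nat) (A : 'M[R]_n)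
    (a : {set 'I_n}) (g : {set 'I_#|a|}) :
  \det (principal_mx (principal_mx A a) g) =
  \det (principal_mx A [set enum_val i | i in g]).
Proof.
pose e (i : 'I_#|g|) : 'I_n := enum_val (enum_val i).
rewrite -(@det_principal_mxsub _ _ _ A e).
- by congr (\det _); apply/matrixP=> i j; rewrite !mxE.
- by move=> i j /enum_val_inj/enum_val_inj.
- exact: codom_enum_val.
Qed.

(** Crabtree-Haynsworth: an entry of [A / A[a]] involves only [A[a]] and the
    row and column of [A] through that entry, so the principal submatrix of
    [A / A[a]] on [g] is the Schur complement of [A[a]] in [A[a :|: g]], and
    [det_block_schur] applies to the latter. *)
Lemma det_principal_schur (R : comUnitRingType) (n : nat) (A : 'M[R]_n)
    (a : {set 'I_n}) (g : {set 'I_#|~: a|}) :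
  principal_mx A a \in unitmx ->
  \det (principal_mx A (a :|: [set enum_val i | i in g])) =
  \det (principal_mx A a) * \det (principal_mx (schur_compl A a) g).
Proof.
move=> uA.
pose e (i : 'I_#|g|) : 'I_n := enum_val (enum_val i).
pose ea (i : 'I_#|a|) : 'I_n := enum_val i.
(* [f] lists [a] first and then [g], so that [mxsub f f A] is a block matrix. *)
pose f (i : 'I_(#|a| + #|g|)) :=
  match split i with inl j => ea j | inr j => e j end.
have fl i : f (lshift _ i) = ea i by rewrite /f (unsplitK (inl _ i)).
have fr i : f (rshift _ i) = e i by rewrite /f (unsplitK (inr _ i)).
have eaP i : ea i \in a by exact: enum_valP.
have eP i : e i \notin a by rewrite -in_setC; exact: enum_valP.
have f_inj : injective f.
  move=> i j; case: (split_ordP i) => i' ->; case: (split_ordP j) => j' ->.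
  - by rewrite !fl => /enum_val_inj ->.
  - by rewrite fl fr => eq_ij; have := eP j'; rewrite -eq_ij eaP.
  - by rewrite fl fr => eq_ij; have := eP i'; rewrite eq_ij eaP.
  - by rewrite !fr => /enum_val_inj/enum_val_inj ->.
rewrite -(det_principal_mxsub A f_inj); last first.
  move=> x; rewrite inE -codom_enum_val.
  apply/codomP/orP => [[i ->] | [xa | /codomP[i ->]]].
  - case: (split_ordP i) => j ->; first by left; rewrite fl.
    by right; rewrite fr; exact: (codom_f e).
  - by exists (lshift _ (enum_rank_in xa x)); rewrite fl /ea enum_rankK_in.
  - by exists (rshift _ i); rewrite fr.
have -> : mxsub f f A =
    block_mx (principal_mx A a) (mxsub ea e A) (mxsub e ea A) (mxsub e e A).
  apply/matrixP=> i j; rewrite mxE.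
  case: (split_ordP i) => i' ->; case: (split_ordP j) => j' ->;
    by rewrite ?fl ?fr ?(block_mxEul, block_mxEur, block_mxEdl, block_mxEdr) mxE.
rewrite det_block_schur //; congr (_ * \det _).
rewrite /principal_mx /schur_compl; apply/matrixP=> i j.
rewrite !mxE; congr (_ - _); apply: eq_bigr => k _; rewrite !mxE.
by congr (_ * _); apply: eq_bigr => l _; rewrite !mxE.
Qed.

Lemma imset_enum_val_sub (n : nat) (a g : {set 'I_n}) :
  g \subset a ->
  [set enum_val i | i in [set i : 'I_#|a| | enum_val i \in g]] = g.
Proof.
move=> /subsetP ga; apply/setP=> x; apply/imsetP/idP => [[i] | xg].
  by rewrite inE => ig ->.
have xa := ga x xg.
by exists (enum_rank_in xa x); rewrite ?inE enum_rankK_in.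
Qed.

Lemma imset_enum_val_subset (n : nat) (a : {set 'I_n}) (g : {set 'I_#|a|}) :
  [set enum_val i | i in g] \subset a.
Proof. by apply/subsetP=> _ /imsetP[i _ ->]; exact: enum_valP. Qed.

(** Turns the N-property of a submatrix, a statement on subsets of ['I_#|a|],
    into one on minors of [A] itself, where index sets can be compared. *)
Lemma principal_N_matrixP (R : numDomainType) (n : nat) (A : 'M[R]_n)
    (a : {set 'I_n}) :
  N_matrix (principal_mx A a) <->
  (forall g : {set 'I_n}, g \subset a -> g != set0 ->
     \det (principal_mx A g) < 0).
Proof.
split=> [NA g ga g0 | NA g g0].
  rewrite -(imset_enum_val_sub ga) -det_principal_principal; apply: NA.
  by rewrite -(imset_eq0 enum_val) imset_enum_val_sub.
rewrite det_principal_principal; apply: NA; first exact: imset_enum_val_subset.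
by rewrite imset_eq0.
Qed.

Theorem theorem3p2 (R : realFieldType) (n : nat) (hn : (0 < n)%N)
    (A : 'M[R]_n) (alpha : {set 'I_n}) (halpha : #|alpha| = 1%N) :
  N_matrix A <->
  N_matrix (principal_mx A alpha) /\ N_matrix (principal_mx A (~: alpha)) /\
  P_matrix (schur_compl A alpha).
Proof.
have alpha0 : alpha != set0 by rewrite -card_gt0 halpha.
have unit_of_neg : \det (principal_mx A alpha) < 0 ->
    principal_mx A alpha \in unitmx.
  by move=> dA; rewrite unitmxE unitfE lt_eqF.
split=> [NA | [/principal_N_matrixP Na [/principal_N_matrixP Nc PS]] g g0].
  have dA := NA _ alpha0.
  split; first by apply/principal_N_matrixP => g _; exact: NA.
  split; first by apply/principal_N_matrixP => g _; exact: NA.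
  move=> g g0; rewrite -(nmulr_rlt0 _ dA) -det_principal_schur ?unit_of_neg //.
  by apply: NA; rewrite setU_eq0 negb_and alpha0.
have [k def_alpha] : exists k, alpha = [set k] by apply/cards1P; rewrite halpha.
have dA := Na _ (subxx _) alpha0.
have [kg | kNg] := boolP (k \in g); last first.
  by apply: Nc g0; rewrite -disjoints_subset def_alpha disjoint_sym disjoints1.
have [-> // | gNalpha] := eqVneq g alpha.
have alpha_g : alpha \subset g by rewrite def_alpha sub1set.
have rest_sub : g :\: alpha \subset ~: alpha by rewrite setDE subsetIr.
have rest0 : g :\: alpha != set0.
  by rewrite setD_eq0; apply: contraNN gNalpha => g_alpha; rewrite eqEsubset g_alpha.
rewrite -(setID g alpha) (setIidPr alpha_g) -(imset_enum_val_sub rest_sub).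
rewrite det_principal_schur ?unit_of_neg // nmulr_rlt0 //; apply: PS.
by rewrite -(imset_eq0 enum_val) imset_enum_val_sub.
Qed.
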